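(* There exist absolute constants $C_1, C_2, c>0$ such that for every integer $d\ge1$ there is $p_0=p_0(d)$ for which the following holds. Let $p_1,p_2$ be positive integers with $p=\max(p_1,p_2)\ge p_0$, and let $d_r,d_c$ be positive integers with $\max(d_r,d_c)=d$. Put $\delta=\lceil C_1\log p\rceil$ and $m=\lceil C_2\sqrt{dp}\,\log p\rceil$ (so $\delta=\mathcal{O}(\log p)$ and $m=\mathcal{O}(\sqrt{dp}\log p)$). Let $X\in\mathbb{R}^{p_1\times p_2}$ be a fixed matrix in which no row has more than $d_r$ non-zero entries and no column has more than $d_c$ non-zero entries. Let $A$ ($m\times p_1$) and $B$ ($m\times p_2$) be drawn independently from the $\delta$-random bipartite ensemble, and let $Y=AXB^T$. Then with probability exceeding $1-p^{-c}$, the optimal solution $X^\ast$ of $$\text{minimize}_{\tilde X\in\mathbb{R}^{p_1\times p_2}}\ \|\tilde X\|_1\quad\text{subject to}\quad A\tilde XB^T=Y$$ equals $X$ (that is, $X$ is the unique optimal solution).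
   Context: Notation: $[q]=\{1,\dots,q\}$; for a matrix $M$, $\|M\|_1=\sum_{i,j}|M_{ij}|$ (entrywise $\ell_1$ norm). $\delta$-random bipartite ensemble of $m\times q$ matrices: for each left vertex $i\in[q]$, choose $\delta$ right vertices $j_1(i),\dots,j_\delta(i)\in[m]$ independently and uniformly at random with replacement, independently over different $i$; this gives a random $\delta$-left regular bipartite (multi)graph with left set $[q]$ and right set $[m]$. The matrix $A\in\mathbb{R}^{m\times q}$ has entries $A_{ji}=\#\{k\in[\delta]: j_k(i)=j\}$ (the number of edges joining left vertex $i$ to right vertex $j$). *)

(* Defs.v *)
From mathcomp Require Import all_boot all_order all_algebra.
From mathcomp Require Import all_classical all_reals all_analysis.

Set Implicit Arguments.
Unset Strict Implicit.
Unset Printing Implicit Defensive.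

Import Order.TTheory GRing.Theory Num.Theory.

Local Open Scope ring_scope.

Definition l1norm (R : realType) (m n : nat) (M : 'M[R]_(m, n)) : R :=
  \sum_(i < m) \sum_(j < n) `|M i j|.

Definition row_sparse (R : realType) (m n k : nat) (M : 'M[R]_(m, n)) : Prop :=
  forall i : 'I_m, (#|[set j : 'I_n | M i j != 0%R]| <= k)%N.

Definition col_sparse (R : realType) (m n k : nat) (M : 'M[R]_(m, n)) : Prop :=
  forall j : 'I_n, (#|[set i : 'I_m | M i j != 0%R]| <= k)%N.

(* [g (i, k)] is the right endpoint of the k-th edge leaving the left vertex i
   in a delta-left-regular bipartite multigraph. *)
Definition left_regular_multigraph (delta m q : nat) : finType :=
  {ffun 'I_q * 'I_delta -> 'I_m}.

Definition biadjacency (R : realType) (delta m q : nat)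
    (g : left_regular_multigraph delta m q) : 'M[R]_(m, q) :=
  \matrix_(j < m, i < q) #|[set k : 'I_delta | g (i, k) == j]|%:R.

(* Drawing all the edge endpoints of two multigraphs independently and
   uniformly from 'I_m is drawing the pair of multigraphs uniformly from the
   finite type of all pairs. *)
Definition uniform_pr (R : realType) (T : finType) (E : T -> Prop) : R :=
  #|[set t : T | `[< E t >]]|%:R / #|T|%:R.

Definition feasible (R : realType) (m p1 p2 : nat) (A : 'M[R]_(m, p1))
    (B : 'M[R]_(m, p2)) (Y : 'M[R]_m) (Z : 'M[R]_(p1, p2)) : Prop :=
  A *m Z *m B^T = Y.

Definition optimal (R : realType) (m p1 p2 : nat) (A : 'M[R]_(m, p1))
    (B : 'M[R]_(m, p2)) (Y : 'M[R]_m) (Z : 'M[R]_(p1, p2)) : Prop :=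
  feasible A B Y Z /\
  forall Z' : 'M[R]_(p1, p2), feasible A B Y Z' -> l1norm Z <= l1norm Z'.

Definition unique_optimal (R : realType) (m p1 p2 : nat) (A : 'M[R]_(m, p1))
    (B : 'M[R]_(m, p2)) (Y : 'M[R]_m) (X : 'M[R]_(p1, p2)) : Prop :=
  optimal A B Y X /\
  forall Z : 'M[R]_(p1, p2), optimal A B Y Z -> Z = X.

(* The absolute value only casts the integer ceiling to nat; it is used on
   nonnegative reals. *)
Definition nat_ceil (R : realType) (x : R) : nat := `|Num.ceil x|%N.

(* Main.v *)
(* For an entry e = (i, i'), its tensor edges are the delta^2 pairs formed by an
   edge leaving i and an edge leaving i'. If at most a third of the tensor edges
   of every e hit a vertex reached by another entry of the support Om of X, then
   every H with A H B^T = 0 has twice as much l1 mass off Om as on Om, so X is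
   the unique minimiser.

   The neighbourhood of Om \ {e}, enlarged so as not to depend on the edges at
   i and i', has at most delta^2 |Om| + 2 d delta m vertices, a small fraction
   of the m^2 available ones because |Om| <= d p. Resampling the edges at i and
   i', splitting the tensor edges into delta matchings of independent edges and
   an exponential moment bound make a third of hits exponentially unlikely in
   delta; a union bound over the p1 p2 entries concludes. *)

Require Import Defs.
From mathcomp Require Import all_boot all_order all_algebra.
From mathcomp Require Import all_classical all_reals all_analysis.
From mathcomp Require Import zify ring lra.

Set Implicit Arguments.
Unset Strict Implicit.
Unset Printing Implicit Defensive.

Import Order.TTheory GRing.Theory Num.Theory.

Local Open Scope ring_scope.

(** * Counting samples with many hits, and resampling *)

Lemma card_bigcup_leq_sum (I T : finType) (P : pred I) (F : I -> {set T}) :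
  (#|(\bigcup_(i | P i) F i)%SET| <= \sum_(i | P i) #|F i|)%N.
Proof.
elim/big_ind2: _ => [|A x B y hA hB|//]; first by rewrite cards0.
exact: leq_trans (leq_card_setU _ _) (leq_add hA hB).
Qed.

(** Chernoff bound by counting: weight [h] by a factor [(2 * q) ^ 3] per hit. A bad [h] weighs at
    least [(2 * q) ^ #|I|], while the total weight factors over [I] into sums that are each at most
    [2 * #|U|]. *)
Lemma card_many_hits (I U : finType) (S : {set U}) (q : nat) :
  (0 < q)%N -> ((2 * q) ^ 3 * #|S| <= #|U|)%N ->
  (#|[set h : {ffun I -> U} | #|I| <= 3 * #|[set i | h i \in S]|]| * q ^ #|I|
     <= #|U| ^ #|I|)%N.
Proof.
move=> q0 hS; set bad := [set h | _].
have moment : (\sum_(h : {ffun I -> U}) ((2 * q) ^ 3) ^ #|[set i | h i \in S]|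
                <= (2 * #|U|) ^ #|I|)%N.
  rewrite (eq_bigr (fun h : {ffun I -> U} =>
      \prod_i ((2 * q) ^ 3) ^ (h i \in S))%N); last first.
    move=> h _; rewrite -expn_sum -sum1_card big_mkcond /=.
    by congr (_ ^ _)%N; apply: eq_bigr => i _; rewrite inE; case: (h i \in S).
  rewrite -(bigA_distr_bigA (fun (_ : I) u => ((2 * q) ^ 3) ^ (u \in S))%N).
  rewrite prod_nat_const; have [->|I0] := posnP #|I|; first by rewrite !expn0.
  rewrite leq_exp2r // [leqRHS]mul2n -addnn.
  have -> : (\sum_u ((2 * q) ^ 3) ^ (u \in S) =
             (2 * q) ^ 3 * #|S| + #|~: S|)%N.
    rewrite (bigID (mem S)) /= (eq_bigr (fun=> ((2 * q) ^ 3)%N)); last first.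
      by move=> u ->; rewrite expn1.
    rewrite sum_nat_const mulnC; congr (_ + _)%N.
    rewrite (eq_bigr (fun=> 1%N)) => [|u /negbTE->//].
    by rewrite -sum1_card; apply: eq_bigl => u; rewrite inE.
  by rewrite leq_add // max_card.
have : (#|bad| * (2 * q) ^ #|I| <= (2 * #|U|) ^ #|I|)%N.
  apply: leq_trans moment; rewrite -sum_nat_const big_mkcond /=.
  apply: leq_sum => h _; case: ifP => // ; rewrite inE => hh.
  by rewrite -expnM leq_pexp2l // muln_gt0.
by rewrite !expnMn mulnCA leq_pmul2l // expn_gt0.
Qed.

(* The pairs (k, k') are split into the n.+1 matchings k' = k + s; along one
   matching the pairs (f.1 k, f.2 (k + s)) are independent. *)
Lemma card_many_pair_hits (n : nat) (U V : finType) (S : {set U * V})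
    (q : nat) :
  (0 < q)%N -> ((2 * q) ^ 3 * #|S| <= #|U| * #|V|)%N ->
  (#|[set f : {ffun 'I_n.+1 -> U} * {ffun 'I_n.+1 -> V} |
        n.+1 ^ 2 <=
        3 * #|[set k : 'I_n.+1 * 'I_n.+1 | (f.1 k.1, f.2 k.2) \in S]|]|
     * q ^ n.+1
   <= n.+1 * #|{: {ffun 'I_n.+1 -> U} * {ffun 'I_n.+1 -> V}}|)%N.
Proof.
move=> q0 hS; set F := ({ffun _ -> U} * {ffun _ -> V})%type.
set bad := [set f | _].
(* Addition in ['I_n.+1] is cyclic, so each shift [s] gives a perfect matching. *)
pose align (s : 'I_n.+1) (f : F) := [ffun k => (f.1 k, f.2 (k + s))].
have align_inj s : injective (align s).
  move=> [f1 f2] [f1' f2'] /ffunP e; congr (_, _); apply/ffunP => k.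
    by move: (e k); rewrite !ffunE => -[].
  by move: (e (k - s)); rewrite !ffunE /= subrK => -[].
pose many := [set h : {ffun 'I_n.+1 -> U * V} |
  #|'I_n.+1| <= 3 * #|[set i | h i \in S]|]%N.
(* Pigeonhole: the matchings partition all pairs, so if a third of the pairs hit [S], then in some
   matching a third do. *)
have cover : bad \subset (\bigcup_s (align s @^-1: many))%SET.
  apply/fintype.subsetP => f; rewrite inE => hf; apply/finset.bigcupP.
  case: (pickP (fun s => align s f \in many)) => [s hs|none].
    by exists s => //; rewrite inE.
  exfalso; move: hf; rewrite leqNgt => /negP; apply.
  rewrite -sum1_card big_mkcond /=.
  under eq_bigr do rewrite inE.
  rewrite -(pair_big xpredT xpredT
    (fun k k' => if (f.1 k, f.2 k') \in S then 1%N else 0%N)) /=.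
  rewrite (eq_bigr (fun k : 'I_n.+1 => \sum_(s : 'I_n.+1)
     if (f.1 k, f.2 (k + s)%R) \in S then 1%N else 0%N))%N; last first.
    by move=> k _; rewrite (reindex_inj (addrI k)).
  rewrite exchange_big big_distrr /=.
  have -> : (n.+1 ^ 2 = \sum_(s < n.+1) n.+1)%N.
    by rewrite sum_nat_const card_ord.
  have lt_s (s : 'I_n.+1) : (3 * (\sum_(k < n.+1)
      if (f.1 k, f.2 (k + s)%R) \in S then 1 else 0) < n.+1)%N.
    move: (none s); rewrite inE card_ord => /negbT; rewrite -ltnNge.
    rewrite -sum1_card big_mkcond /=; congr (3 * _ < _)%N.
    by apply: eq_bigr => k _; rewrite inE ffunE.
  (* The term [ord0] supplies the strict inequality; weak ones suffice for the rest. *)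
  rewrite (bigD1 ord0) //= [leqRHS](bigD1 ord0) //= -addSn.
  by apply: leq_add => //; apply: leq_sum => s _; exact: ltnW.
have -> : #|{: F}| = (#|{: U * V}| ^ #|'I_n.+1|)%N.
  by rewrite !card_prod !card_ffun expnMn.
rewrite -[X in (_ <= X * _)%N](card_ord n.+1) -[leqRHS]sum_nat_const.
apply: (@leq_trans (\sum_(s < n.+1) #|align s @^-1: many| * q ^ n.+1)%N).
  rewrite -big_distrl /= leq_mul2r; apply/orP; right.
  exact: leq_trans (subset_leq_card cover) (card_bigcup_leq_sum _ _).
apply: leq_sum => s _.
have := @card_many_hits 'I_n.+1 _ S q q0; rewrite card_prod => /(_ hS).
apply: leq_trans; rewrite card_ord leq_mul2r; apply/orP; right.
rewrite -(card_imset _ (align_inj s)); apply: subset_leq_card.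
by apply/fintype.subsetP => _ /imsetP[f + ->]; rewrite !inE card_ord.
Qed.

(* [swap] exchanges part of the sample [t] with an independent fresh copy [f]. *)
Lemma card_resample (T F : finType) (swap : T * F -> T * F) (bad : {set T})
    (b : nat) :
  injective swap ->
  (forall t, #|[set f | (swap (t, f)).1 \in bad]| <= b)%N ->
  (#|bad| * #|F| <= #|T| * b)%N.
Proof.
move=> swap_inj hb.
have <- : #|finset.setX bad [set: F]| = (#|bad| * #|F|)%N.
  by rewrite cardsX cardsT.
(* An injection of a finite set into itself is a bijection, so the bad pairs are as many as their
   preimages under [swap], which are counted fibre by fibre over [t]. *)
rewrite -(card_preimset _ swap_inj) -sum1_card big_mkcond /=.
rewrite (eq_bigr (fun u =>
  if (u.1, u.2) \in swap @^-1: finset.setX bad [set: F] then 1%N else 0%N));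
  last by case.
rewrite -(pair_big xpredT xpredT (fun t f =>
  if (t, f) \in swap @^-1: finset.setX bad [set: F] then 1%N else 0%N)) /=.
rewrite -sum_nat_const; apply: leq_sum => t _; rewrite -big_mkcond sum1_card.
apply: leq_trans (hb t); apply: subset_leq_card.
apply/fintype.subsetP => f h.
have : (t, f) \in swap @^-1: finset.setX bad [set: F] by exact: h.
by rewrite !inE andbT.
Qed.

(** * Collisions in a random pair of multigraphs *)

Definition edges delta m q (g : left_regular_multigraph delta m q) (a : 'I_q)
    (j : 'I_m) : bool :=
  [exists k : 'I_delta, g (a, k) == j].

Definition collides delta m p1 p2 (Om : {set 'I_p1 * 'I_p2})
    (g : left_regular_multigraph delta m p1 * left_regular_multigraph delta m p2)
    (e : 'I_p1 * 'I_p2) (v : 'I_m * 'I_m) : bool :=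
  [exists e' in Om :\ e, edges g.1 e'.1 v.1 && edges g.2 e'.2 v.2].

(** Counting edge labels rather than vertices keeps multiplicities, as the biadjacency matrices
    do. *)
Definition collisions delta m p1 p2 (Om : {set 'I_p1 * 'I_p2})
    (g : left_regular_multigraph delta m p1 * left_regular_multigraph delta m p2)
    (e : 'I_p1 * 'I_p2) : nat :=
  #|[set k : 'I_delta * 'I_delta |
      collides Om g e (g.1 (e.1, k.1), g.2 (e.2, k.2))]|.

Lemma card_edges delta m q (g : left_regular_multigraph delta m q) (a : 'I_q) :
  (#|[set j | edges g a j]| <= delta)%N.
Proof.
apply: (@leq_trans #|[set g (a, k) | k in 'I_delta]|).
  apply: subset_leq_card; apply/fintype.subsetP => j; rewrite inE.
  by case/existsP => k /eqP <-; exact: imset_f.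
by apply: leq_trans (leq_imset_card _ _) _; rewrite card_ord.
Qed.

(** Swapping instead of overwriting makes this an involution, hence the injection that
    [card_resample] asks for. *)
Definition exchange (I K M : finType) (i : I)
    (u : {ffun I * K -> M} * {ffun K -> M}) : {ffun I * K -> M} * {ffun K -> M} :=
  ([ffun x => if x.1 == i then u.2 x.2 else u.1 x], [ffun k => u.1 (i, k)]).

Lemma exchangeK (I K M : finType) (i : I) : involutive (@exchange I K M i).
Proof.
move=> [g f]; congr (_, _); apply/ffunP => x; rewrite !ffunE /=.
  by case: x => a k /=; case: eqP => [->|].
by rewrite eqxx.
Qed.

Definition exchange2 delta m p1 p2 (e : 'I_p1 * 'I_p2)
    (u : (left_regular_multigraph delta m p1 * left_regular_multigraph delta m p2)
         * ({ffun 'I_delta -> 'I_m} * {ffun 'I_delta -> 'I_m})) :=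
  let x := exchange e.1 (u.1.1, u.2.1) in
  let y := exchange e.2 (u.1.2, u.2.2) in
  ((x.1, y.1), (x.2, y.2)).

Lemma exchange2K delta m p1 p2 e : involutive (@exchange2 delta m p1 p2 e).
Proof.
move=> [[g1 g2] [f1 f2]].
exact: (congr2 (fun x y => ((x.1, y.1), (x.2, y.2)))
  (exchangeK e.1 (g1, f1)) (exchangeK e.2 (g2, f2))).
Qed.

(* A superset of the vertices colliding with [e] that does not depend on the
   edges leaving [e.1] and [e.2]: the entries in the row or the column of [e]
   are given all the vertices in the resampled coordinate. *)
Definition shadow delta m p1 p2 (Om : {set 'I_p1 * 'I_p2})
    (g : left_regular_multigraph delta m p1 * left_regular_multigraph delta m p2)
    (e : 'I_p1 * 'I_p2) : {set 'I_m * 'I_m} :=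
  [set v | [exists e' in Om :\ e,
     ((e'.1 == e.1) || edges g.1 e'.1 v.1)
     && ((e'.2 == e.2) || edges g.2 e'.2 v.2)]].

Lemma collides_exchange2 delta m p1 p2 (Om : {set 'I_p1 * 'I_p2}) g e f v :
  collides Om (@exchange2 delta m p1 p2 e (g, f)).1 e v -> v \in shadow Om g e.
Proof.
case/existsP => e' /and3P[e'Om h1 h2]; rewrite inE; apply/existsP; exists e'.
rewrite e'Om /=; apply/andP; split.
  case: eqP => //= /eqP/negbTE ne; case/existsP: h1 => k; rewrite ffunE /= ne => hk.
  by apply/existsP; exists k.
case: eqP => //= /eqP/negbTE ne; case/existsP: h2 => k; rewrite ffunE /= ne => hk.
by apply/existsP; exists k.
Qed.

Lemma card_bigcup_leq (I T : finType) (A : {set I}) (F : I -> {set T}) (b : nat) :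
  (forall i, i \in A -> #|F i| <= b)%N ->
  (#|(\bigcup_(i in A) F i)%SET| <= #|A| * b)%N.
Proof.
move=> hF; apply: leq_trans (card_bigcup_leq_sum _ _) _.
by rewrite -sum_nat_const; exact: leq_sum.
Qed.

(** An entry outside the row and column of [e] reaches at most [delta * delta] vertices. The row and
    the column each hold at most [d] entries, and each of these is charged a full coordinate,
    [delta * m] vertices. *)
Lemma card_shadow delta m p1 p2 (Om : {set 'I_p1 * 'I_p2}) g e d :
  (forall a, #|[set b | (a, b) \in Om]| <= d)%N ->
  (forall b, #|[set a | (a, b) \in Om]| <= d)%N ->
  (#|@shadow delta m p1 p2 Om g e| <=
     #|Om| * (delta * delta) + 2 * (d * (delta * m)))%N.
Proof.
move=> hrow hcol.
pose S0 := (\bigcup_(e' in Om)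
  finset.setX [set j | edges g.1 e'.1 j] [set l | edges g.2 e'.2 l])%SET.
pose S1 := (\bigcup_(b in [set b | (e.1, b) \in Om])
  finset.setX [set: 'I_m] [set l | edges g.2 b l])%SET.
pose S2 := (\bigcup_(a in [set a | (a, e.2) \in Om])
  finset.setX [set j | edges g.1 a j] [set: 'I_m])%SET.
have sub : shadow Om g e \subset S0 :|: (S1 :|: S2).
  apply/fintype.subsetP => v; rewrite inE => /existsP[[a b]] /and3P[].
  rewrite !inE /= => /andP[ne abOm].
  have [ea|na] /= := eqVneq a e.1; have [eb|nb] /= := eqVneq b e.2 => h1 h2.
  (* An entry sharing both coordinates with [e] would be [e] itself. *)
  - by move: ne; rewrite ea eb -surjective_pairing eqxx.
  - apply/orP; right; apply/orP; left; apply/finset.bigcupP; exists b.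
      by rewrite inE -ea.
    by rewrite !inE.
  - apply/orP; right; apply/orP; right; apply/finset.bigcupP; exists a.
      by rewrite inE -eb.
    by rewrite !inE h1.
  - apply/orP; left; apply/finset.bigcupP; exists (a, b) => //.
    by rewrite !inE h1.
apply: leq_trans (subset_leq_card sub) _.
apply: leq_trans (leq_card_setU _ _) _; apply: leq_add.
  apply: card_bigcup_leq => e' _; rewrite cardsX.
  by apply: leq_mul; exact: card_edges.
apply: leq_trans (leq_card_setU _ _) _; rewrite mul2n -addnn; apply: leq_add.
  apply: leq_trans (leq_mul (hrow e.1) (leqnn _)).
  apply: card_bigcup_leq => b _; rewrite cardsX cardsT card_ord mulnC.
  by rewrite leq_mul2r card_edges orbT.
apply: leq_trans (leq_mul (hcol e.2) (leqnn _)).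
apply: card_bigcup_leq => a _; rewrite cardsX cardsT card_ord.
by rewrite leq_mul2r card_edges orbT.
Qed.

(** For fixed [g] the shadow is a fixed set of density at most [(2 * q) ^ -3], and the fresh edges
    at [e.1] and [e.2] are independent of it, so [card_many_pair_hits] bounds each fibre of the
    resampling. *)
Lemma card_many_collisions delta m p1 p2 (Om : {set 'I_p1 * 'I_p2}) e d q :
  (0 < delta)%N -> (0 < m)%N -> (0 < q)%N ->
  (forall a, #|[set b | (a, b) \in Om]| <= d)%N ->
  (forall b, #|[set a | (a, b) \in Om]| <= d)%N ->
  ((2 * q) ^ 3 * (#|Om| * (delta * delta) + 2 * (d * (delta * m))) <= m * m)%N ->
  (#|[set g : left_regular_multigraph delta m p1 *
              left_regular_multigraph delta m p2 |
       delta ^ 2 <= 3 * collisions Om g e]| * q ^ delta <=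
   delta * #|{: left_regular_multigraph delta m p1 *
                left_regular_multigraph delta m p2}|)%N.
Proof.
case: delta => // n _ m0 q0 hrow hcol hm; set bad := [set g | _].
pose F := ({ffun 'I_n.+1 -> 'I_m} * {ffun 'I_n.+1 -> 'I_m})%type.
have F0 : (0 < #|{: F}|)%N by rewrite card_prod !card_ffun muln_gt0 expn_gt0 card_ord m0.
(* Cardinals are integers, so rounding the fibre bound down loses nothing. *)
pose b := (n.+1 * #|{: F}| %/ q ^ n.+1)%N.
have := @card_resample _ _ _ bad b (inv_inj (@exchange2K n.+1 m p1 p2 e)).
have hb g : (#|[set f | (exchange2 e (g, f)).1 \in bad]| <= b)%N.
  rewrite leq_divRL ?expn_gt0 ?q0 //.
  have := @card_many_pair_hits n _ _ (shadow Om g e) q q0.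
  rewrite !card_ord => hits; apply: leq_trans (hits _); last first.
    by apply: leq_trans hm; rewrite leq_mul2l card_shadow ?orbT.
  (* After the exchange the tensor edges of [e] come from [f], and those that collide land in the
     shadow computed from [g]. *)
  rewrite leq_mul2r; apply/orP; right; apply: subset_leq_card.
  apply/fintype.subsetP => f; rewrite !inE => /leq_trans; apply.
  rewrite leq_mul2l /=; apply: subset_leq_card; apply/fintype.subsetP => k.
  by rewrite !inE => /collides_exchange2; rewrite !ffunE /= !eqxx inE.
move=> /(_ hb) h; rewrite -(leq_pmul2r F0) mulnAC.
apply: (@leq_trans (#|_| * b * q ^ n.+1)%N).
  by rewrite leq_mul2r; apply/orP; right; exact: h.
by rewrite -mulnA [leqRHS]mulnAC mulnC leq_mul2r leq_divM orbT.
Qed.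

(** * The null-space inequality and l1 recovery *)

(* At a vertex [v] met by a unique entry [e] of [Om], the equation
   [\sum_e M v e * H e = 0] bounds [M v e * `|H e|] by the mass outside [Om];
   the vertices met by several entries of [Om] are discarded. *)
Lemma nullspace_vertex (R : realDomainType) (E : finType) (Om : {set E})
    (M : E -> R) (H : E -> R) (h : pred E) :
  (forall e, h e = [exists e' in Om :\ e, M e' != 0]) ->
  (forall e, 0 <= M e) -> \sum_e M e * H e = 0 ->
  \sum_(e in Om) M e * (~~ h e)%:R * `|H e|
    <= \sum_(e in ~: Om) M e * (h e)%:R * `|H e|.
Proof.
move=> hE M0 eq0.
have nneg : 0 <= \sum_(e in ~: Om) M e * (h e)%:R * `|H e|.
  by apply: sumr_ge0 => e _; rewrite !mulr_ge0 ?ler0n.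
(* If no entry of [Om] meets the vertex without collision, the left side vanishes. *)
case: (pickP (fun e => [&& e \in Om, M e != 0 & ~~ h e])) => [e0|none]; last first.
  rewrite big1 // => e eOm; move: (none e); rewrite eOm /=.
  case: eqVneq => [->|_] /=; first by rewrite !mul0r.
  by move=> ->; rewrite mulr0 mul0r.
case/and3P=> e0Om Me0 nh0.
have M_eq0 e : e \in Om -> e != e0 -> M e = 0.
  move=> eOm ne; apply/eqP; apply: contraNT nh0 => Me.
  by rewrite hE; apply/existsP; exists e; rewrite !inE ne eOm.
rewrite (bigD1 e0) //= big1 ?addr0 => [|e /andP[eOm ne]]; last first.
  by rewrite M_eq0 // !mul0r.
rewrite nh0 mulr1.
have -> : M e0 * `|H e0| = `|\sum_(e in ~: Om) M e * H e|.
  move: eq0; rewrite (bigID (mem Om)) /= (bigD1 e0) //= big1 ?addr0; last first.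
    by move=> e /andP[eOm ne]; rewrite M_eq0 // mul0r.
  move/eqP; rewrite addr_eq0 => /eqP eqe.
  rewrite -(ger0_norm (M0 e0)) -normrM eqe normrN; congr `|_|.
  by apply: eq_bigl => e; rewrite inE.
apply: le_trans (ler_norm_sum _ _ _) _; apply: ler_sum => e; rewrite inE => eOm.
(* An entry outside [Om] differs from [e0], which meets the vertex, so it collides. *)
have -> : h e.
  by rewrite hE; apply/existsP; exists e0; rewrite !inE e0Om Me0 (memPn eOm).
by rewrite mulr1 normrM ger0_norm.
Qed.

(** Sum [nullspace_vertex] over [v]. An entry of [Om] keeps its non-colliding mass, at least
    [2 * D / 3]; one outside contributes its colliding mass, at most [D / 3]. *)
Lemma nullspace_property (R : realFieldType) (V E : finType) (Om : {set E})
    (M : V -> E -> R) (D : R) (H : E -> R) :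
  (forall v e, 0 <= M v e) -> (forall e, \sum_v M v e = D) ->
  (forall e, 3 * \sum_v M v e * [exists e' in Om :\ e, M v e' != 0]%:R <= D) ->
  0 < D -> (forall v, \sum_e M v e * H e = 0) ->
  2 * \sum_(e in Om) `|H e| <= \sum_(e in ~: Om) `|H e|.
Proof.
move=> M0 MD Mh D0 eq0.
pose c e := \sum_v M v e * [exists e' in Om :\ e, M v e' != 0]%:R.
have key : \sum_(e in Om) (D - c e) * `|H e| <= \sum_(e in ~: Om) c e * `|H e|.
  pose h v e := [exists e' in Om :\ e, M v e' != 0].
  have : \sum_v \sum_(e in Om) M v e * (~~ h v e)%:R * `|H e|
      <= \sum_v \sum_(e in ~: Om) M v e * (h v e)%:R * `|H e|.
    by apply: ler_sum => v _; exact: nullspace_vertex.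
  rewrite exchange_big [leRHS]exchange_big /=; congr (is_true (_ <= _)).
    apply: eq_bigr => e _; rewrite -mulr_suml; congr (_ * _).
    rewrite -(MD e) -sumrB; apply: eq_bigr => v _.
    by rewrite -/(h v e); case: (h v e); rewrite /= ?mulr0 ?mulr1 ?subrr ?subr0.
  by apply: eq_bigr => e _; rewrite -mulr_suml.
have lb : \sum_(e in Om) (2 * D) * `|H e| <= \sum_(e in Om) 3 * ((D - c e) * `|H e|).
  apply: ler_sum => e _; rewrite mulrA ler_wpM2r //.
  by have := Mh e; rewrite -/(c e); lra.
have ub : \sum_(e in ~: Om) 3 * (c e * `|H e|) <= \sum_(e in ~: Om) D * `|H e|.
  by apply: ler_sum => e _; rewrite mulrA ler_wpM2r //; exact: Mh.
rewrite -(ler_pM2l D0) mulrA (mulrC D) mulr_sumr [leRHS]mulr_sumr.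
apply: le_trans lb _; apply: le_trans ub.
by rewrite -!mulr_sumr ler_pM2l.
Qed.

(** Adding [H] costs at most its mass on [Om] and gains all its mass off [Om]; by hypothesis the net
    gain is at least a third of the mass of [H]. This margin yields uniqueness. *)
Lemma l1_recovery (R : realFieldType) (E : finType) (Om : {set E}) (X H : E -> R) :
  (forall e, e \notin Om -> X e = 0) ->
  2 * \sum_(e in Om) `|H e| <= \sum_(e in ~: Om) `|H e| ->
  3 * \sum_e `|X e| + \sum_e `|H e| <= 3 * \sum_e `|X e + H e|.
Proof.
move=> X0 hH.
have split F : \sum_e F e = \sum_(e in Om) F e + \sum_(e in ~: Om) F e :> R.
  by rewrite (bigID (mem Om)) /=; congr (_ + _); apply: eq_bigl => e; rewrite inE.
rewrite !split.
have -> : \sum_(e in ~: Om) `|X e| = 0.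
  by apply: big1 => e; rewrite inE => /X0 ->; rewrite normr0.
have -> : \sum_(e in ~: Om) `|X e + H e| = \sum_(e in ~: Om) `|H e|.
  by apply: eq_bigr => e; rewrite inE => /X0 ->; rewrite add0r.
have : \sum_(e in Om) `|X e| <= \sum_(e in Om) `|X e + H e| + \sum_(e in Om) `|H e|.
  rewrite -big_split; apply: ler_sum => e _ /=.
  by rewrite -[X in `|X| <= _](addrK (H e)) (le_trans (ler_normB _ _)).
have : 0 <= \sum_(e in Om) `|H e| by apply: sumr_ge0.
lra.
Qed.

(** * From multigraphs to the minimisation problem *)

Lemma biadjacencyE (R : realType) delta m q (g : left_regular_multigraph delta m q) j a :
  biadjacency R g j a = \sum_k (g (a, k) == j)%:R.
Proof.
rewrite mxE -sum1_card natr_sum big_mkcond /=; apply: eq_bigr => k _.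
by rewrite inE; case: eqP.
Qed.

Lemma biadjacency_neq0 (R : realType) delta m q
    (g : left_regular_multigraph delta m q) j a :
  (biadjacency R g j a != 0) = edges g a j.
Proof.
rewrite mxE pnatr_eq0 cards_eq0; apply/set0Pn/existsP => -[k hk]; exists k.
  by move: hk; rewrite inE.
by rewrite inE.
Qed.

(** Each tensor edge contributes at its own endpoint only. The true predicate gives the total mass
    [delta ^ 2], and [collides] gives [collisions]. *)
Lemma sum_biadjacency2 (R : realType) delta m p1 p2
    (g1 : left_regular_multigraph delta m p1)
    (g2 : left_regular_multigraph delta m p2) a b (P : pred ('I_m * 'I_m)) :
  \sum_v biadjacency R g1 v.1 a * biadjacency R g2 v.2 b * (P v)%:R =
  #|[set k : 'I_delta * 'I_delta | P (g1 (a, k.1), g2 (b, k.2))]|%:R.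
Proof.
rewrite -sum1_card natr_sum [RHS]big_mkcond /=.
rewrite (eq_bigr (fun v : 'I_m * 'I_m => \sum_(k : 'I_delta * 'I_delta)
  ((g1 (a, k.1), g2 (b, k.2)) == v)%:R * (P v)%:R)); last first.
  move=> v _; rewrite !biadjacencyE -mulr_suml; congr (_ * _).
  rewrite big_distrlr /= pair_big /=; apply: eq_bigr => k _.
  by rewrite -pair_eqE /= -natrM mulnb.
rewrite exchange_big /=; apply: eq_bigr => k _; rewrite inE.
rewrite (bigD1 (g1 (a, k.1), g2 (b, k.2))) //= eqxx mul1r big1 ?addr0.
  by case: (P _).
by move=> v ne; rewrite eq_sym (negbTE ne) mul0r.
Qed.

Lemma unique_optimal_of_few_collisions (R : realType) delta m p1 p2
    (X : 'M[R]_(p1, p2))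
    (g : left_regular_multigraph delta m p1 * left_regular_multigraph delta m p2) :
  (0 < delta)%N ->
  (forall e, 3 * collisions [set e : 'I_p1 * 'I_p2 | X e.1 e.2 != 0%R] g e
               <= delta ^ 2)%N ->
  let A := biadjacency R g.1 in let B := biadjacency R g.2 in
  unique_optimal A B (A *m X *m B^T) X.
Proof.
move=> d0 few A B; set Om := [set e | _] in few.
(* The Kronecker product of [A] and [B], which turns [A H B^T = 0] into one linear equation per
   vertex. *)
pose M (v : 'I_m * 'I_m) (e : 'I_p1 * 'I_p2) := A v.1 e.1 * B v.2 e.2.
have collE v e : [exists e' in Om :\ e, M v e' != 0] = collides Om g e v.
  by apply: eq_existsb => e'; rewrite mulf_eq0 negb_or !biadjacency_neq0.
have M0 v e : 0 <= M v e by rewrite /M !mxE mulr_ge0 ?ler0n.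
have MD e : \sum_v M v e = (delta ^ 2)%:R.
  have := sum_biadjacency2 R g.1 g.2 e.1 e.2 xpredT.
  under eq_bigr do rewrite mulr1; move=> ->; congr _%:R.
  rewrite (_ : [set _ | _] = [set: _]); last by apply/setP => k; rewrite !inE.
  by rewrite cardsT card_prod card_ord.
have Mh e : 3 * \sum_v M v e * [exists e' in Om :\ e, M v e' != 0]%:R
              <= (delta ^ 2)%:R.
  under eq_bigr do rewrite collE.
  by rewrite sum_biadjacency2 -natrM ler_nat; exact: few.
have l1E (Z : 'M[R]_(p1, p2)) : l1norm Z = \sum_e `|Z e.1 e.2|.
  by rewrite /l1norm pair_big.
(* This single inequality gives both optimality and uniqueness of [X]. *)
have recover Z : feasible A B (A *m X *m B^T) Z ->
    3 * l1norm X + l1norm (Z - X) <= 3 * l1norm Z.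
  move=> feasZ; rewrite !l1E.
  have D0 : 0 < (delta ^ 2)%:R :> R by rewrite ltr0n expn_gt0 d0.
  have eq0 (v : 'I_m * 'I_m) : \sum_e M v e * (Z - X) e.1 e.2 = 0.
    have : (A *m (Z - X) *m B^T) v.1 v.2 = 0.
      by rewrite mulmxBr mulmxBl feasZ subrr mxE.
    rewrite mxE => h; rewrite -[RHS]h; under [RHS]eq_bigr do rewrite mxE mulr_suml.
    rewrite [RHS]exchange_big [RHS]pair_big /=; apply: eq_bigr => e _.
    by rewrite /M [B^T _ _]mxE mulrAC.
  have nsp := nullspace_property M0 MD Mh D0 eq0.
  have X0 e : e \notin Om -> X e.1 e.2 = 0 by rewrite inE negbK => /eqP.
  apply: le_trans (l1_recovery X0 nsp) _.
  rewrite ler_pM2l //; apply: ler_sum => e _.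
  by rewrite (_ : X _ _ + _ = Z e.1 e.2) // !mxE; ring.
have norm_ge0 (Z : 'M[R]_(p1, p2)) : 0 <= l1norm Z.
  by rewrite l1E; apply: sumr_ge0.
split; first split=> // Z /recover; first by have := norm_ge0 (Z - X); lra.
move=> Z [feasZ /(_ X erefl) leZX].
have : l1norm (Z - X) = 0.
  by apply/eqP; rewrite eq_le norm_ge0 andbT; have := recover _ feasZ; lra.
rewrite l1E => /psumr_eq0P h; apply/matrixP => a b; apply/eqP.
have /eqP := h (fun _ _ => normr_ge0 _) (a, b) isT.
by rewrite normr_eq0 !mxE subr_eq0.
Qed.

(** * Numerical parameters and the probability bound *)

Lemma nat_ceil_ge (R : realType) (x : R) : 0 <= x -> x <= (nat_ceil x)%:R.
Proof.
move=> x0; rewrite /nat_ceil natr_absz ger0_norm ?ceil_ge //.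
by rewrite ceil_ge0 (lt_le_trans _ x0) // ltrN10.
Qed.

Lemma nat_ceil_ltD1 (R : realType) (x : R) : 0 <= x -> (nat_ceil x)%:R < x + 1.
Proof.
move=> x0; rewrite /nat_ceil natr_absz ger0_norm; last first.
  by rewrite ceil_ge0 (lt_le_trans _ x0) // ltrN10.
by have /andP[] := ceil_itv x; rewrite intrB ltrBlDr.
Qed.

(** Let [L] be the binary logarithm of [p] and [s] the root of [d * p]. Since [L >= 1], rounding
    puts [delta] between [L] and [2 * L], whence [m >= K * s * delta]. Squaring gives the second
    bound; the third uses [s >= 2 * K * d]. *)
Lemma parameter_bounds (R : realType) (K d p delta m : nat) :
  (0 < K)%N -> (0 < d)%N -> ((2 * K) ^ 2 * d <= p)%N ->
  delta = nat_ceil ((ln 2)^-1 * ln (p%:R : R)) ->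
  m = nat_ceil (2 * K%:R / ln 2 * Num.sqrt ((d * p)%:R : R) * ln (p%:R : R)) ->
  [/\ (p <= 2 ^ delta)%N,
      (K ^ 2 * (d * p * (delta * delta)) <= m * m)%N &
      (2 * K ^ 2 * (d * delta) <= m)%N].
Proof.
move=> K0 d0 hp hdelta hm.
have k0 : 0 <= K%:R :> R by exact: ler0n.
have hpR : (2 * K%:R) ^+ 2 * d%:R <= p%:R :> R.
  by rewrite -natrM -natrX -natrM ler_nat.
have p2 : 2 <= p%:R :> R by rewrite ler_nat; apply: leq_trans hp; nia.
have ln2 : 0 < ln 2 :> R by rewrite ln_gt0 // ltr1n.
pose L : R := (ln 2)^-1 * ln p%:R.
have L1 : 1 <= L.
  rewrite /L mulrC ler_pdivlMr // mul1r ler_ln // posrE //.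
  by apply: lt_le_trans p2.
have L0 : 0 <= L by apply: le_trans L1.
pose s : R := Num.sqrt (d * p)%:R.
have s0 : 0 <= s by exact: sqrtr_ge0.
have s2 : s ^+ 2 = d%:R * p%:R by rewrite sqr_sqrtr // natrM.
have sd : 2 * K%:R * d%:R <= s.
  rewrite -(@ler_pXn2r _ 2) ?nnegrE ?mulr_ge0 ?ler0n // s2 exprMn.
  by rewrite [d%:R ^+ 2]expr2 mulrA mulrC ler_wpM2l.
have delta_ge : L <= delta%:R by rewrite hdelta nat_ceil_ge.
have delta_le : delta%:R <= 2 * L.
  by have := nat_ceil_ltD1 L0; rewrite -hdelta; lra.
have mE : 2 * K%:R / ln 2 * Num.sqrt ((d * p)%:R : R) * ln (p%:R : R) =
    K%:R * s * (2 * L) by rewrite /L /s; ring.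
have m_ge : K%:R * s * delta%:R <= m%:R.
  apply: (@le_trans _ _ (K%:R * s * (2 * L))).
    by rewrite ler_wpM2l // mulr_ge0.
  rewrite hm mE; apply: nat_ceil_ge.
  by rewrite (mulr_ge0 (mulr_ge0 k0 s0)) // mulr_ge0.
split.
- rewrite -(ler_nat R) natrX -ler_ln ?posrE ?exprn_gt0 //; last first.
    exact: lt_le_trans p2.
  rewrite lnXn // -[leRHS]mulr_natl -ler_pdivrMr //.
  by rewrite mulrC.
- rewrite -(ler_nat R) !natrM.
  have -> : K%:R * K%:R * (d%:R * p%:R * (delta%:R * delta%:R)) =
    (K%:R * s * delta%:R) * (K%:R * s * delta%:R) :> R.
    by rewrite -s2; ring.
  by rewrite ler_pM // !mulr_ge0.
- rewrite -(ler_nat R) !natrM; apply: le_trans m_ge.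
  have -> : 2 * (K%:R * K%:R) * (d%:R * delta%:R) =
    K%:R * (2 * K%:R * d%:R) * delta%:R :> R by ring.
  by rewrite ler_wpM2r // ler_wpM2l.
Qed.

(** The bad fraction is at most [1 / p]; the exponent [1 / 2] leaves room for strictness. *)
Lemma uniform_pr_gt (R : realType) (T : finType) (E : T -> Prop)
    (bad : {set T}) (p : nat) :
  (1 < p)%N -> (0 < #|T|)%N -> (#|bad| * p <= #|T|)%N ->
  (forall t, t \notin bad -> E t) ->
  1 - p%:R `^ (- 2^-1) < uniform_pr R E.
Proof.
move=> p1 T0 hbad good.
have p0 : 0 < p%:R :> R by rewrite ltr0n (ltn_trans _ p1).
have T0R : 0 < #|T|%:R :> R by rewrite ltr0n.
have gt_inv : p%:R^-1 < p%:R `^ (- 2^-1) :> R.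
  rewrite powRN powR12_sqrt ?ler0n // ltf_pV2 ?posrE ?sqrtr_gt0 //.
  rewrite -(@ltr_pXn2r _ 2) ?nnegrE ?sqrtr_ge0 ?ler0n // sqr_sqrtr ?ler0n //.
  by rewrite expr2 ltr_pMr // ltr1n.
rewrite /uniform_pr ltr_pdivlMr //.
apply: (@lt_le_trans _ _ ((1 - p%:R^-1) * #|T|%:R)).
  by rewrite ltr_pM2r // ltrD2l ltrN2.
apply: (@le_trans _ _ (#|~: bad|%:R)); last first.
  rewrite ler_nat; apply: subset_leq_card; apply/fintype.subsetP => t.
  by rewrite !inE => /good.
have cardT : #|bad|%:R + #|~: bad|%:R = #|T|%:R :> R by rewrite -natrD cardsC.
have : #|bad|%:R <= p%:R^-1 * #|T|%:R :> R.
  by rewrite mulrC ler_pdivlMr // -natrM ler_nat.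
by rewrite mulrBl mul1r -cardT; lra.
Qed.

(** * The union bound over entries *)

Theorem corollary2 (R : realType) :
  exists C1 C2 c : R, [/\ 0 < C1, 0 < C2, 0 < c &
    forall d : nat, (1 <= d)%N ->
    exists p0 : nat,
    forall p1 p2 : nat, (0 < p1)%N -> (0 < p2)%N ->
    forall p : nat, p = maxn p1 p2 -> (p0 <= p)%N ->
    forall dr dc : nat, (0 < dr)%N -> (0 < dc)%N -> maxn dr dc = d ->
    forall delta m : nat,
      delta = nat_ceil (C1 * ln (p%:R : R)) ->
      m = nat_ceil (C2 * Num.sqrt ((d * p)%:R : R) * ln (p%:R : R)) ->
    forall X : 'M[R]_(p1, p2), row_sparse dr X -> col_sparse dc X ->
      uniform_pr R
        (fun g : left_regular_multigraph delta m p1 *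
                 left_regular_multigraph delta m p2 =>
           let A := biadjacency R g.1 in
           let B := biadjacency R g.2 in
           unique_optimal A B (A *m X *m B^T) X)
      > 1 - (p%:R : R) `^ (- c)].
Proof.
(* The density condition is used with [q = 16]; the extra factor 2 gives each of the two terms of
   the shadow bound half of [m * m]. *)
have [K [K0 hK]] : exists K, (0 < K)%N /\ (K ^ 2 = 2 * (2 * 16) ^ 3)%N.
  by exists (2 ^ 8)%N; rewrite expn_gt0 (_ : 2 * 16 = 2 ^ 5)%N // -!expnM -expnS.
exists (ln 2)^-1, (2 * K%:R / ln 2), 2^-1.
have ln2 : 0 < ln 2 :> R by rewrite ln_gt0 // ltr1n.
split; rewrite ?invr_gt0 ?divr_gt0 ?mulr_gt0 ?ltr0n //.
move=> d d0; exists ((2 * K) ^ 2 * d)%N => p1 p2 p1_gt0 p2_gt0 p hp hp0 dr dc _ _ hd.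
move=> delta m hdelta hm X rowX colX.
have [p_le hm1 hm2] := parameter_bounds K0 d0 hp0 hdelta hm.
have p_gt1 : (1 < p)%N by apply: leq_trans hp0; nia.
have delta0 : (0 < delta)%N by case: (delta) p_le => //; rewrite leqNgt p_gt1.
have m0 : (0 < m)%N.
  by apply: leq_trans hm2; rewrite !muln_gt0 K0 d0 delta0.
have [p1_le p2_le] : (p1 <= p)%N /\ (p2 <= p)%N by rewrite hp leq_maxl leq_maxr.
pose Om := [set e : 'I_p1 * 'I_p2 | X e.1 e.2 != 0%R].
have row_le a : (#|[set b | (a, b) \in Om]| <= d)%N.
  rewrite -hd; apply: leq_trans (leq_maxl dr dc); apply: leq_trans (rowX a).
  by apply: subset_leq_card; apply/fintype.subsetP => b; rewrite !inE.
have col_le b : (#|[set a | (a, b) \in Om]| <= d)%N.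
  rewrite -hd; apply: leq_trans (leq_maxr dr dc); apply: leq_trans (colX b).
  by apply: subset_leq_card; apply/fintype.subsetP => a; rewrite !inE.
have Om_le : (#|Om| <= d * p)%N.
  rewrite -sum1_card big_mkcond /=.
  rewrite (eq_bigr (fun e => if (e.1, e.2) \in Om then 1%N else 0%N)); last by case.
  rewrite -(pair_big xpredT xpredT
    (fun a b => if (a, b) \in Om then 1%N else 0%N)) /=.
  apply: (@leq_trans (\sum_(a < p1) d)); last first.
    by rewrite sum_nat_const card_ord mulnC leq_mul2l p1_le orbT.
  apply: leq_sum => a _; apply: leq_trans (row_le a).
  rewrite -sum1_card [leqRHS]big_mkcond /=.
  by apply: leq_sum => b _; rewrite !inE.
set T := (left_regular_multigraph delta m p1 *
          left_regular_multigraph delta m p2)%type.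
pose bad_at e := [set g : T | delta ^ 2 <= 3 * collisions Om g e]%N.
pose bad := (\bigcup_e bad_at e)%SET.
have bad_at_le e : (#|bad_at e| * 16 ^ delta <= delta * #|{: T}|)%N.
  have := @card_many_collisions _ _ _ _ Om e d 16 delta0 m0 isT row_le col_le.
  apply.
  move: hm1 hm2; rewrite hK; move: ((2 * 16) ^ 3)%N => Q hm1 hm2.
  rewrite -(leq_pmul2l (isT : 0 < 2)%N).
  have h1 : (2 * Q * (#|Om| * (delta * delta)) <= m * m)%N.
    by apply: leq_trans hm1; rewrite leq_mul2l leq_mul2r Om_le !orbT.
  have h2 : (2 * (2 * Q) * (d * delta) * m <= m * m)%N by rewrite leq_mul2r hm2 orbT.
  have -> : (2 * (Q * (#|Om| * (delta * delta) + 2 * (d * (delta * m)))) =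
    2 * Q * (#|Om| * (delta * delta)) + 2 * (2 * Q) * (d * delta) * m)%N by ring.
  by rewrite [leqRHS]mul2n -addnn leq_add.
apply: (@uniform_pr_gt _ _ _ bad) => //.
- by rewrite card_prod !card_ffun muln_gt0 !expn_gt0 card_ord m0.
- have bad_le : (#|bad| * 8 ^ delta <= p * p * #|{: T}|)%N.
    (* Of [16 ^ delta], a factor [2 ^ delta] absorbs the number [delta] of matchings. The remaining
       [8 ^ delta >= p ^ 3] beats the at most [p ^ 2] entries and leaves [1 / p]. *)
    have delta_le : (delta <= 2 ^ delta)%N by rewrite ltnW // ltn_expl.
    rewrite -(@leq_pmul2l (2 ^ delta)) ?expn_gt0 //.
    rewrite mulnCA -expnMn.
    apply: (@leq_trans (\sum_e #|bad_at e| * 16 ^ delta)%N).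
      rewrite -big_distrl /= leq_mul2r; apply/orP; right.
      exact: card_bigcup_leq_sum.
    apply: (@leq_trans (\sum_(e : 'I_p1 * 'I_p2) delta * #|{: T}|)%N).
      by apply: leq_sum => e _; exact: bad_at_le.
    rewrite sum_nat_const card_prod !card_ord mulnCA leq_mul //.
    by rewrite leq_mul2r leq_mul ?orbT.
  have pp : (p * p * p <= 8 ^ delta)%N.
    by rewrite -[8%N]/(2 * 2 * 2)%N !expnMn !leq_mul.
  rewrite -(@leq_pmul2l (p * p)) ?muln_gt0 ?(ltnW p_gt1) //.
  apply: leq_trans bad_le; rewrite mulnCA leq_mul2l; apply/orP; right.
  by rewrite mulnC in pp *.
- move=> g /finset.bigcupP nbad; apply: unique_optimal_of_few_collisions => // e.
  rewrite leqNgt; apply/negP => /ltnW he; apply: nbad; exists e => //.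
  by rewrite inE.
Qed.
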